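(* Let $u$, $u_{h_k}$ ($k\in\mathbb N_0$), $\mathcal I_{M_k}$ ($k\in\mathbb N_0$) and $u_K^{(\mathrm{ML})}$ be as described in the context. Suppose there are positive constants $\alpha,\beta,C_s,C_I,C_\zeta$, independent of $k$, such that: (i) $\|u-u_{h_k}\|_{L^2_\rho(\Gamma;H^1_0(D))}\le C_s\,h_k^\alpha$ for all $k\in\mathbb N_0$; (ii) there are a Banach space $\Lambda(\Gamma;H^1_0(D))\subset L^2_\rho(\Gamma;H^1_0(D))$ containing $u_{h_k}$ for all $k\in\mathbb N_0$, a function $\zeta:\Lambda(\Gamma;H^1_0(D))\to\mathbb R$ and a decreasing (not necessarily strictly) sequence $(\sigma_k)_{k\in\mathbb N_0}$ such that for all $v\in\Lambda(\Gamma;H^1_0(D))$ and all $k\in\mathbb N_0$ $$\|v-\mathcal I_{M_k}v\|_{L^2_\rho(\Gamma;H^1_0(D))}\le C_I\,\sigma_k\,\zeta(v),$$ and $\zeta(u_{h_k})\le C_\zeta h_0^\beta$ and $\zeta(u_{h_{k+1}}-u_{h_k})\le C_\zeta h_{k+1}^\beta$ for all $k\in\mathbb N_0$. Let $K\in\mathbb N$ and suppose that the interpolation operators are chosen such that $$\sigma_{K-k}\le C_s\,\big((K+1)\,C_I\,C_\zeta\big)^{-1}\,h_K^\alpha\,h_k^{-\beta}\qquad\text{for } k=0,\dots,K.$$ Then $$\|u-u_K^{(\mathrm{ML})}\|_{L^2_\rho(\Gamma;H^1_0(D))}\le 2\,C_s\,h_K^\alpha.$$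
   Context: Setting. $D\subset\mathbb R^d$ ($d=1,2,3$) is a bounded Lipschitz domain, $\Gamma=[-1,1]^N$, and $\rho\in L^\infty(\Gamma)$ is a product probability density on $\Gamma$. The coefficient $a(\bm y,\mathbf x)$ satisfies $0<a_{\min}\le a(\bm y,\mathbf x)\le a_{\max}<\infty$ for almost every $\bm y$ and all $\mathbf x\in\overline D$, and $f\in L^2_\rho(\Gamma;H^{-1}(D))$. The function $u\in L^2_\rho(\Gamma;H^1_0(D))$ is the unique solution of $-\nabla\cdot(a(\bm y,\mathbf x)\nabla u(\bm y,\mathbf x))=f(\bm y,\mathbf x)$ in $D$, $u(\bm y,\cdot)=0$ on $\partial D$; it is assumed that $u\in C^0(\Gamma;H^1_0(D))$. The Bochner norm is $\|v\|^2_{L^2_\rho(\Gamma;H^1_0(D))}=\int_\Gamma\|v(\bm y,\cdot)\|_{H^1_0(D)}^2\rho(\bm y)\,\mathrm d\bm y$. Spatial approximation. $V_{h_0}\subset V_{h_1}\subset\dots\subset H^1_0(D)$ are nested finite element spaces of continuous piecewise polynomials on shape-regular triangulations with maximum mesh width $h_k=\eta^{-k}h_0$, for some integer $\eta>1$. $u_{h_k}(\bm y,\cdot)\in V_{h_k}$ is the Galerkin finite element approximation of $u(\bm y,\cdot)$. Set $u_{h_{-1}}:=0$. Interpolation. $(\mathcal I_{M_k})_{k\in\mathbb N_0}$ is a sequence of interpolation operators $\mathcal I_{M_k}:C^0(\Gamma)\to L^2_\rho(\Gamma)$ using $M_k$ points (repetitions $M_{k+1}=M_k$, $\mathcal I_{M_{k+1}}=\mathcal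 I_{M_k}$ are allowed). With points $\bm y_1,\dots,\bm y_M$ and a basis $\{\phi_m\}_{m=1}^M\subset L^2_\rho(\Gamma)$ of the interpolation space, the operator is applied to functions $v$ on $\Gamma$ with values in $H^1_0(D)$ via $\mathcal I_M[v](\bm y,\mathbf x)=\sum_{m=1}^M c_m(\mathbf x)\phi_m(\bm y)$, where the $c_m$ are determined by $\mathcal I_M[v](\bm y_m,\cdot)=v(\bm y_m,\cdot)$, $m=1,\dots,M$. The elements of $\Lambda(\Gamma;H^1_0(D))$ are understood to be functions to which these operators can be applied. Multilevel approximation. $$u_K^{(\mathrm{ML})}:=\sum_{k=0}^K\mathcal I_{M_{K-k}}[u_{h_k}-u_{h_{k-1}}].$$
   Formalization: The sequence (σ_k) is additionally assumed to be nonnegative; without this the statement is false (e.g. σ_k = −1, C_I = 1, ζ(v) = −‖v − I v‖ with the same one-point interpolation I at every level). *)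

(* Defs.v *)
From HB Require Import structures.
From mathcomp Require Import all_boot all_order all_algebra.
From mathcomp Require Import all_classical all_reals all_analysis.
From mathcomp Require Import measurable_realfun ring.
From mathcomp Require mpoly.

Set Implicit Arguments.
Unset Strict Implicit.
Unset Printing Implicit Defensive.

Import Order.TTheory GRing.Theory Num.Theory.
Import numFieldNormedType.Exports.

Local Open Scope classical_set_scope.
Local Open Scope ring_scope.

Section rn.
Context (R : realType).

Definition cylinders n : set (set 'rV[R]_n) :=
  [set A | exists (i : 'I_n) (B : set (measurableTypeR R)),
     measurable B /\ A = [set x : 'rV[R]_n | B (x ord0 i)]].

(* The carrier is 'rV[R]_n, with the product of the Borel sigma-algebras of
   the coordinates, i.e. the Borel sigma-algebra of R^n. *)
Definition rn n : Type := g_sigma_algebraType (@cylinders n).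
HB.instance Definition _ n := Measurable.on (rn n).

Definition rn_cons n (p : measurableTypeR R * rn n) : rn n.+1 :=
  (\row_(i < n.+1) if unlift ord0 i is Some j then (p.2 : 'rV[R]_n) ord0 j
                   else p.1).

Lemma measurable_rn_coord n (i : 'I_n) :
  measurable_fun [set: rn n] (fun x : rn n => (x : 'rV[R]_n) ord0 i : measurableTypeR R).
Proof.
move=> _ B mB; rewrite setTI; apply: sub_sigma_algebra.
by exists i, B.
Qed.

Lemma measurable_rn d (T : measurableType d) n (f : T -> rn n) :
  (forall i, measurable_fun setT (fun t => (f t : 'rV[R]_n) ord0 i : measurableTypeR R)) ->
  measurable_fun setT f.
Proof.
move=> mf; refine (@measurability _ _ _ _ setT f (@cylinders n) erefl _).
move=> _ [_ [i [B [mB ->]]] <-].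
exact: (mf i measurableT B mB).
Qed.

Lemma measurable_rn_cons n : measurable_fun setT (@rn_cons n).
Proof.
apply: measurable_rn => i; rewrite /rn_cons.
case: (unliftP ord0 i) => [j|] ->.
  under eq_fun do rewrite mxE liftK.
  exact: measurableT_comp (measurable_rn_coord j) measurable_snd.
by under eq_fun do rewrite mxE unlift_none; exact: measurable_fst.
Qed.

Definition rn_uncons n (x : rn n.+1) : measurableTypeR R * rn n :=
  ((x : 'rV[R]_n.+1) ord0 ord0, \row_(i < n) (x : 'rV[R]_n.+1) ord0 (lift ord0 i)).

Lemma rn_consK n : cancel (@rn_cons n) (@rn_uncons n).
Proof.
case=> a x; rewrite /rn_cons /rn_uncons; congr pair.
  by rewrite mxE unlift_none.
by apply/rowP => i; rewrite !mxE liftK.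
Qed.

Lemma measurable_rn_uncons n : measurable_fun setT (@rn_uncons n).
Proof.
apply: measurable_fun_pair; first exact: measurable_rn_coord.
apply: measurable_rn => i /=.
under eq_fun do rewrite mxE.
exact: measurable_rn_coord.
Qed.

Section step.
Context n (m : {sigma_finite_measure set (rn n) -> \bar R}).

Definition rn_step : set (rn n.+1) -> \bar R :=
  pushforward ((@lebesgue_measure R) \x m)%E (@rn_cons n).

Let rn_step0 : rn_step set0 = 0%E.
Proof. by rewrite /rn_step /pushforward preimage_set0 measure0. Qed.

Let rn_step_ge0 A : (0 <= rn_step A)%E.
Proof. by rewrite /rn_step /pushforward; exact: measure_ge0. Qed.

Let rn_step_sigma_additive : semi_sigma_additive rn_step.
Proof.
move=> F mF tF mUF; rewrite /rn_step /pushforward preimage_bigcup.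
have mc A : measurable A -> measurable (@rn_cons n @^-1` A).
  by move=> mA; rewrite -[X in measurable X]setTI; exact: measurable_rn_cons.
apply: measure_semi_sigma_additive => [k| |]; first exact: mc.
- apply/trivIsetP => /= i j _ _ ij; rewrite -preimage_setI.
  by move/trivIsetP : tF => /(_ _ _ _ _ ij) ->//; rewrite preimage_set0.
- by rewrite -preimage_bigcup; exact: mc.
Qed.

HB.instance Definition _ := isMeasure.Build _ _ _ rn_step
  rn_step0 rn_step_ge0 rn_step_sigma_additive.

Let rn_step_sigma_finite : sigma_finite setT rn_step.
Proof.
have /sigma_finiteP[F [TF ndF Foo]] := sigma_finiteT (@lebesgue_measure R).
have /sigma_finiteP[G [TG ndG Goo]] := sigma_finiteT m.
exists (fun k => @rn_uncons n @^-1` (F k `*` G k)).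
  rewrite -preimage_bigcup (_ : \bigcup_k _ = setT) ?preimage_setT//.
  rewrite -setXTT TF TG predeqE => -[x y]; split.
    by move=> [n0 _ []/= ? ?]; split; exists n0.
  move=> [/= [p _ Fpx] [k _ Gky]]; exists (maxn p k) => //; split.
  - by move: x Fpx; exact/subsetPset/ndF/leq_maxl.
  - by move: y Gky; exact/subsetPset/ndG/leq_maxr.
move=> k; have [mF Fk] := Foo k; have [mG Gk] := Goo k; split.
  rewrite -[X in measurable X]setTI; apply: measurable_rn_uncons => //.
  exact: measurableX.
rewrite /rn_step /pushforward -comp_preimage.
rewrite (_ : _ @^-1` _ = F k `*` G k); last first.
  by apply/seteqP; split => x; rewrite /preimage /mkset [(_ \o _) x]rn_consK.
by rewrite product_measure1E// lte_mul_pinfty// ge0_fin_numE.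
Qed.

HB.instance Definition _ := Measure_isSigmaFinite.Build _ _ _ rn_step
  rn_step_sigma_finite.

End step.

Fixpoint rn_lebesgue n : {sigma_finite_measure set (rn n) -> \bar R} :=
  match n with
  | 0 => \d_((0 : 'rV[R]_0) : rn 0)
  | n'.+1 => rn_step (rn_lebesgue n')
  end.

End rn.


Section lspace.
Context d (T : measurableType d) (R : realType).
Context (mu : {measure set T -> \bar R}) (p : \bar R) (p1 : (1 <= p)%E).

Definition ae_null : {pred LfunType mu p1} :=
  fun f => `[< {ae mu, forall x, f x = 0} >].

Lemma ae_null_submod_closed : submod_closed ae_null.
Proof.
split; first by apply/asboolP; exact: aeW.
move=> a f g /asboolP f0 /asboolP g0; apply/asboolP.
apply: filterS2 f0 g0 => x /= f0 g0.
by change (a * f x + g x = 0); rewrite f0 g0 mulr0 addr0.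
Qed.

HB.instance Definition _ := GRing.isSubmodClosed.Build _ _ ae_null
  ae_null_submod_closed.

Definition lspace : Type := Quotient.quot ae_null.

HB.instance Definition _ := GRing.Zmodule.on lspace.

Definition lspace_fun (f : lspace) : LfunType mu p1 := repr f.

Definition lspace_class (f : LfunType mu p1) : lspace := \pi_(Quotient.quot ae_null)%qT f.

Lemma lspace_funK : cancel lspace_fun lspace_class.
Proof. exact: reprK. Qed.

Lemma lspace_classP (f g : LfunType mu p1) :
  lspace_class f = lspace_class g <-> {ae mu, forall x, f x = g x}.
Proof.
split.
  move/eqP; rewrite eqmodE /= => /asboolP.
  apply: filterS => x fg0; apply/eqP; rewrite -subr_eq0; apply/eqP; exact: fg0.
move=> fg; apply/eqP; rewrite eqmodE /=; apply/asboolP.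
by apply: filterS fg => x fg; change (f x - g x = 0); rewrite fg subrr.
Qed.

Lemma lspace_classK f : {ae mu, forall x, lspace_fun (lspace_class f) x = f x}.
Proof. by apply/lspace_classP; rewrite lspace_funK. Qed.

Lemma lspace_classD f g :
  lspace_class (f + g) = lspace_class f + lspace_class g.
Proof. exact: (@Quotient.pi_add _ ae_null). Qed.

Definition lspace_scale (a : R) (f : lspace) := lspace_class (a *: lspace_fun f).

Lemma lspace_classZ a f : lspace_class (a *: f) = lspace_scale a (lspace_class f).
Proof.
apply/lspace_classP; apply: filterS (lspace_classK f) => x e.
by change (a * f x = a * lspace_fun (lspace_class f) x); rewrite e.
Qed.

Fact lspace_scaleA a b v :
  lspace_scale a (lspace_scale b v) = lspace_scale (a * b) v.
Proof. by rewrite -(lspace_funK v) -!lspace_classZ scalerA. Qed.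

Fact lspace_scale1 : left_id 1 lspace_scale.
Proof. by move=> v; rewrite -(lspace_funK v) -!lspace_classZ scale1r. Qed.

Fact lspace_scaleDr : right_distributive lspace_scale +%R.
Proof.
move=> a u v; rewrite -(lspace_funK v) -(lspace_funK u).
by rewrite -lspace_classD -!lspace_classZ -lspace_classD scalerDr.
Qed.

Fact lspace_scaleDl v : {morph lspace_scale^~ v : a b / a + b}.
Proof.
move=> a b; rewrite -(lspace_funK v).
by rewrite -!lspace_classZ -lspace_classD scalerDl.
Qed.

HB.instance Definition _ := GRing.Zmodule_isLmodule.Build R lspace
  lspace_scaleA lspace_scale1 lspace_scaleDr lspace_scaleDl.

Lemma lspace_funD f g :
  {ae mu, forall x, lspace_fun (f + g) x = lspace_fun f x + lspace_fun g x}.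
Proof.
have /lspace_classP : lspace_class (lspace_fun (f + g)) =
    lspace_class (lspace_fun f + lspace_fun g).
  by rewrite lspace_classD !lspace_funK.
exact.
Qed.

Lemma lspace_funZ a f :
  {ae mu, forall x, lspace_fun (a *: f) x = a * lspace_fun f x}.
Proof.
have /lspace_classP : lspace_class (lspace_fun (a *: f)) =
    lspace_class (a *: lspace_fun f).
  by rewrite lspace_classZ !lspace_funK.
exact.
Qed.

Lemma lspace_fun0 : {ae mu, forall x, lspace_fun 0 x = 0}.
Proof.
have /lspace_classP : lspace_class (lspace_fun 0) = lspace_class 0.
  by rewrite lspace_funK -(scale0r (0 : lspace)) -(scale0r (0 : LfunType mu p1))
    lspace_classZ; rewrite /GRing.scale/= /lspace_scale; congr lspace_class;
    rewrite !scale0r.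
exact.
Qed.

End lspace.

Section L2.
Context d (T : measurableType d) (R : realType).
Context (mu : {measure set T -> \bar R}).

Definition L2 : Type := lspace mu (lee1n 2).
HB.instance Definition _ := GRing.Lmodule.on L2.

Definition L2_norm (f : L2) : R := fine 'N[mu]_2[EFin \o lspace_fun f].

Lemma L2_normE f : (L2_norm f)%:E = 'N[mu]_2[EFin \o lspace_fun f]%E.
Proof. exact: finite_norm_fine. Qed.

Lemma ae_eq_Lnorm2 (f g : LfunType mu (lee1n 2)) :
  {ae mu, forall x, f x = g x} ->
  'N[mu]_2[EFin \o f]%E = 'N[mu]_2[EFin \o g]%E.
Proof.
have E (h : LfunType mu (lee1n 2)) :
    'N[mu]_2[EFin \o h]%E = ((\int[mu]_x (`|h x| `^ 2)%:E) `^ 2^-1)%E.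
  by rewrite unlock; congr poweR; apply: eq_integral => x _; rewrite /= poweR_EFin.
have mE (h : LfunType mu (lee1n 2)) : measurable_fun setT (fun x => `|h x| `^ 2).
  apply: (measurableT_comp (measurable_powR _)) => //.
  exact: measurableT_comp.
move=> fg; rewrite !E; congr poweR; apply: ae_eq_integral => //.
- exact/measurable_EFinP.
- exact/measurable_EFinP.
- by apply: filterS fg => x /= -> _.
Qed.

Lemma L2_normD f g : L2_norm (f + g) <= L2_norm f + L2_norm g.
Proof.
rewrite -lee_fin EFinD !L2_normE.
rewrite (@ae_eq_Lnorm2 _ (lspace_fun f + lspace_fun g)).
  by apply: eminkowski => //; exact: lee1n.
exact: lspace_funD.
Qed.

Lemma L2_normZ a f : L2_norm (a *: f) = `|a| * L2_norm f.
Proof.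
apply: EFin_inj; rewrite EFinM !L2_normE.
rewrite (@ae_eq_Lnorm2 _ (a *: lspace_fun f)) ?LnormZ//.
exact: lspace_funZ.
Qed.

Lemma L2_norm0_eq0 f : L2_norm f = 0 -> f = 0.
Proof.
move=> /fine_Lnormr_eq0 f0.
rewrite -(lspace_funK f) -(lspace_funK 0); apply/lspace_classP.
by apply: filterS2 f0 (@lspace_fun0 _ _ _ mu _ (lee1n 2)) => x -> // ->.
Qed.

HB.instance Definition _ := Lmodule_isNormed.Build R L2
  L2_normD L2_normZ L2_norm0_eq0.

End L2.


Section test_function.
Context (R : realType) (d : nat).
Implicit Types (phi psi : 'rV[R]_d -> R) (s : seq 'I_d).

Definition partial (i : 'I_d) phi : 'rV[R]_d -> R :=
  fun x => 'D_(delta_mx ord0 i) phi x.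

Definition partials s phi : 'rV[R]_d -> R := foldr partial phi s.

Definition smooth phi := forall s x, differentiable (partials s phi) x.

(* C_c^oo(D), the functions being extended by 0 outside D *)
Definition test_function (D : set 'rV[R]_d) phi :=
  smooth phi /\
  exists K, [/\ compact K, K `<=` D & forall x, ~ K x -> phi x = 0].

Lemma partials_lin s (a : R) phi psi : smooth phi -> smooth psi ->
  partials s (a *: phi + psi) = a *: partials s phi + partials s psi.
Proof.
move=> sphi spsi; elim: s => //= i s ->; apply/funext => x.
have dphi : derivable (partials s phi) x (delta_mx ord0 i).
  exact/diff_derivable/sphi.
have dpsi : derivable (partials s psi) x (delta_mx ord0 i).
  exact/diff_derivable/spsi.
rewrite /partial deriveD//; last exact: derivableZ.
by rewrite deriveZ.
Qed.

Lemma test_function_lin D a phi psi :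
  test_function D phi -> test_function D psi -> test_function D (a *: phi + psi).
Proof.
move=> [sphi [K [cK KD phi0]]] [spsi [L [cL LD psi0]]]; split.
  move=> s x; rewrite partials_lin//; apply: differentiableD; last exact: spsi.
  apply: differentiableZ; exact: sphi.
exists (K `|` L); split; first exact: compactU.
  by rewrite subUset.
move=> x /not_orP[nK nL].
by change (a * phi x + psi x = 0); rewrite phi0// psi0// mulr0 addr0.
Qed.

Lemma partials0 s : partials s (0 : 'rV[R]_d -> R) = 0.
Proof.
elim: s => //= i s ->; apply/funext => x.
exact: derive_cst.
Qed.

Lemma test_function0 D : test_function D (0 : 'rV[R]_d -> R).
Proof.
split; last by exists set0; split => //; exact: compact0.
by move=> s x; rewrite partials0; exact: differentiable_cst.
Qed.

End test_function.

Section h10.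
Context (R : realType) (d : nat).

Definition jet : Type := (L2 (rn_lebesgue R d) * ('I_d -> L2 (rn_lebesgue R d)))%type.
HB.instance Definition _ := GRing.Lmodule.on jet.

Definition is_jet (phi : 'rV[R]_d -> R) (z : jet) :=
  {ae rn_lebesgue R d, forall x, lspace_fun z.1 x = phi x} /\
  forall i, {ae rn_lebesgue R d, forall x, lspace_fun (z.2 i) x = partial i phi x}.

(* the H^1 norm: square root of |v|_{L^2}^2 + |grad v|_{L^2}^2 *)
Definition jet_norm (z : jet) : R :=
  Num.sqrt (`|z.1| ^+ 2 + \sum_(i < d) `|z.2 i| ^+ 2).

Lemma sqrt_sum_sqr_triangle (I : finType) (a b : I -> R) :
  Num.sqrt (\sum_i (a i + b i) ^+ 2) <=
  Num.sqrt (\sum_i a i ^+ 2) + Num.sqrt (\sum_i b i ^+ 2).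
Proof.
set A := \sum_i a i ^+ 2; set B := \sum_i b i ^+ 2; pose C := \sum_i a i * b i.
have A0 : 0 <= A by apply: sumr_ge0 => i _; exact: sqr_ge0.
have B0 : 0 <= B by apply: sumr_ge0 => i _; exact: sqr_ge0.
have abE : \sum_i (a i + b i) ^+ 2 = A + C *+ 2 + B.
  by rewrite /A /B /C -sumrMnl -!big_split/=; apply: eq_bigr => i _; rewrite sqrrD.
have CAB : C ^+ 2 <= A * B.
  have [A00|A1] := eqVneq A 0.
    suff -> : C = 0 by rewrite expr0n mulr_ge0.
    rewrite /C big1// => i _; suff -> : a i = 0 by rewrite mul0r.
    apply/eqP; rewrite -sqrf_eq0; apply/eqP.
    by apply: (psumr_eq0P _ A00) => // k _; exact: sqr_ge0.
  have : 0 <= \sum_i (A * b i - C * a i) ^+ 2.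
    by apply: sumr_ge0 => i _; exact: sqr_ge0.
  have -> : \sum_i (A * b i - C * a i) ^+ 2 =
      A ^+ 2 * B - (A * C * C) *+ 2 + C ^+ 2 * A.
    have e1 : A ^+ 2 * B = \sum_i A ^+ 2 * b i ^+ 2 by rewrite mulr_sumr.
    have e2 : A * C * C = \sum_i A * C * (a i * b i) by rewrite mulr_sumr.
    have e3 : C ^+ 2 * A = \sum_i C ^+ 2 * a i ^+ 2 by rewrite mulr_sumr.
    rewrite e1 e2 e3 -sumrMnl -sumrB -big_split/=.
    by apply: eq_bigr => i _; ring.
  have -> : A ^+ 2 * B - (A * C * C) *+ 2 + C ^+ 2 * A = A * (A * B - C ^+ 2).
    by ring.
  by rewrite pmulr_rge0 ?subr_ge0// lt_neqAle eq_sym A1.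
rewrite abE -(@ler_pXn2r _ 2)// ?nnegrE ?addr_ge0 ?sqrtr_ge0//.
rewrite sqrrD !sqr_sqrtr//; last first.
  by rewrite -abE; apply: sumr_ge0 => i _; exact: sqr_ge0.
rewrite lerD2r lerD2l lerMn2r/= -sqrtrM//.
apply: (le_trans (ler_norm _)); rewrite -sqrtr_sqr; exact: ler_wsqrtr.
Qed.

Lemma jet_normD z w : jet_norm (z + w) <= jet_norm z + jet_norm w.
Proof.
pose c (z : jet) (i : 'I_d.+1) := if unlift ord0 i is Some j then `|z.2 j| else `|z.1|.
have cE z0 : `|z0.1| ^+ 2 + \sum_(i < d) `|z0.2 i| ^+ 2 = \sum_i c z0 i ^+ 2.
  rewrite big_ord_recl /c unlift_none; congr (_ + _).
  by apply: eq_bigr => i _; rewrite liftK.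
rewrite /jet_norm !cE; apply: le_trans (sqrt_sum_sqr_triangle _ _).
apply: ler_wsqrtr; apply: ler_sum => i _.
have c0 z0 k : 0 <= c z0 k by rewrite /c; case: unlift.
rewrite ler_sqr ?nnegrE ?addr_ge0// /c.
by case: unlift => [j|]; exact: ler_normD.
Qed.

Lemma jet_normZ a z : jet_norm (a *: z) = `|a| * jet_norm z.
Proof.
rewrite /jet_norm -sqrtr_sqr -sqrtrM ?sqr_ge0// mulrDr mulr_sumr.
congr (Num.sqrt (_ + _)).
  by rewrite normrZ exprMn real_normK// num_real.
by apply: eq_bigr => i _; rewrite normrZ exprMn real_normK// num_real.
Qed.

Lemma jet_norm0_eq0 z : jet_norm z = 0 -> z = 0.
Proof.
move=> /eqP; rewrite sqrtr_eq0 => z0.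
have z1 : `|z.1| = 0.
  apply/eqP; rewrite -sqrf_eq0; apply/eqP/le_anti; rewrite sqr_ge0 andbT.
  by apply: le_trans z0; rewrite lerDl sumr_ge0// => i _; exact: sqr_ge0.
have z2 i : `|z.2 i| = 0.
  apply/eqP; rewrite -sqrf_eq0; apply/eqP/le_anti; rewrite sqr_ge0 andbT.
  apply: le_trans z0; rewrite z1 expr0n add0r (bigD1 i)//= lerDl.
  by apply: sumr_ge0 => j _; exact: sqr_ge0.
case: z z1 z2 {z0} => z1 z2 /= /eqP; rewrite normr_eq0 => /eqP -> h.
congr pair; apply/funext => i; apply/eqP; rewrite -normr_eq0; exact/eqP.
Qed.

(* A function v of H^1_0(D) is represented by the pair of v and of its weak
   gradient, both extended by 0 outside D: these pairs are the closure of the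
   pairs (phi, grad phi) with phi in C_c^oo(D). *)
Definition h10_pred (D : set 'rV[R]_d) : {pred jet} := fun z =>
  `[< forall e, 0 < e -> exists phi w,
        [/\ test_function D phi, is_jet phi w & jet_norm (z - w) < e] >].

Lemma is_jet_lin D a phi psi z w : test_function D phi -> test_function D psi ->
  is_jet phi z -> is_jet psi w -> is_jet (a *: phi + psi) (a *: z + w).
Proof.
move=> [sphi _] [spsi _] [z1 z2] [w1 w2]; split.
  have H1 := lspace_funD (a *: z.1) w.1.
  have H2 := lspace_funZ a z.1.
  apply: filterS2 (filterI H1 H2) (filterI z1 w1) => x [e1 e2] [h1 h2].
  by rewrite [LHS]e1 e2 h1 h2.
move=> i.
have H1 := lspace_funD (a *: z.2 i) (w.2 i).
have H2 := lspace_funZ a (z.2 i).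
have E := @partials_lin _ _ [:: i] a _ _ sphi spsi.
apply: filterS2 (filterI H1 H2) (filterI (z2 i) (w2 i)) => x [e1 e2] [h1 h2].
rewrite [LHS]e1 e2 h1 h2; change (a * partial i phi x + partial i psi x =
  partials [:: i] (a *: phi + psi) x); by rewrite E.
Qed.

Lemma h10_pred_submod_closed D : submod_closed (h10_pred D).
Proof.
split.
  apply/asboolP => e e0; exists 0, 0; split => //.
  - exact: test_function0.
  - split; first exact: lspace_fun0.
    move=> i; apply: filterS (@lspace_fun0 _ _ _ (rn_lebesgue R d) _ (lee1n 2)) => x.
    move=> /= ->; have -> : partial i (0 : 'rV[R]_d -> R) = 0 := partials0 R [:: i].
    by [].
  - rewrite subr0 (_ : jet_norm 0 = 0)//.
    by have := jet_normZ 0 (0 : jet); rewrite scale0r normr0 mul0r.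
move=> a z w /asboolP Hz /asboolP Hw; apply/asboolP => e e0.
have a1 : 0 < `|a| + 1 by rewrite ltr_wpDl.
have [|phi [z' [tphi jz nz]]] := Hz (e / 2 / (`|a| + 1)).
  by rewrite !divr_gt0.
have [|psi [w' [tpsi jw nw]]] := Hw (e / 2); first by rewrite divr_gt0.
exists (a *: phi + psi), (a *: z' + w'); split.
- exact: test_function_lin.
- exact: (is_jet_lin _ tphi tpsi).
- rewrite opprD addrACA -scalerBr.
  apply: (le_lt_trans (jet_normD _ _)).
  rewrite [ltRHS]splitr; apply: ler_ltD => //.
  rewrite jet_normZ; move: nz; rewrite ltr_pdivlMr// => /ltW.
  apply: le_trans; rewrite mulrC ler_wpM2l ?sqrtr_ge0//.
  by rewrite lerDl.
Qed.

HB.instance Definition _ D := GRing.isSubmodClosed.Build _ _ (h10_pred D)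
  (h10_pred_submod_closed D).

Record H10 (D : set 'rV[R]_d) := MkH10 {
  h10_jet : jet ; _ : h10_jet \in h10_pred D }.

HB.instance Definition _ D := [isSub for @h10_jet D].
HB.instance Definition _ D := gen_eqMixin (H10 D).
HB.instance Definition _ D := gen_choiceMixin (H10 D).
HB.instance Definition _ D := [SubChoice_isSubLmodule of H10 D by <:].

Definition h10_norm D (v : H10 D) : R := jet_norm (h10_jet v).

Lemma h10_normD D (v w : H10 D) : h10_norm (v + w) <= h10_norm v + h10_norm w.
Proof. exact: jet_normD. Qed.

Lemma h10_normZ D a (v : H10 D) : h10_norm (a *: v) = `|a| * h10_norm v.
Proof. exact: jet_normZ. Qed.

Lemma h10_norm0_eq0 D (v : H10 D) : h10_norm v = 0 -> v = 0.
Proof. by move=> /jet_norm0_eq0 v0; exact: val_inj. Qed.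

HB.instance Definition _ D := Lmodule_isNormed.Build R (H10 D)
  (@h10_normD D) (@h10_normZ D) (@h10_norm0_eq0 D).

Definition h10_fun D (v : H10 D) : 'rV[R]_d -> R := lspace_fun (h10_jet v).1.

Definition h10_grad D (v : H10 D) (i : 'I_d) : 'rV[R]_d -> R :=
  lspace_fun ((h10_jet v).2 i).

End h10.


Section dual_space.
Context (R : realType) (W : normedModType R).

Definition dual_pred : {pred (W -> R)} := fun f =>
  `[< (forall a x y, f (a *: x + y) = a * f x + f y) /\
      exists M, forall x, `|f x| <= M * `|x| >].

Lemma dual_pred_submod_closed : submod_closed dual_pred.
Proof.
split.
  apply/asboolP; split; first by move=> a x y; rewrite /= mulr0 addr0.
  by exists 0 => x; rewrite normr0 mul0r.
move=> a f g /asboolP[lf [M fM]] /asboolP[lg [N gN]]; apply/asboolP; split.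
  move=> b x y; change (a * f (b *: x + y) + g (b *: x + y) =
    b * (a * f x + g x) + (a * f y + g y)).
  by rewrite lf lg; ring.
exists (`|a| * M + N) => x; change (`|a * f x + g x| <= (`|a| * M + N) * `|x|).
rewrite mulrDl (le_trans (ler_normD _ _))// lerD// normrM -mulrA.
by rewrite ler_wpM2l.
Qed.

HB.instance Definition _ := GRing.isSubmodClosed.Build _ _ dual_pred
  dual_pred_submod_closed.

Record dual_space := MkDual { dual_fun :> W -> R ; _ : dual_fun \in dual_pred }.

HB.instance Definition _ := [isSub for dual_fun].
HB.instance Definition _ := gen_eqMixin dual_space.
HB.instance Definition _ := gen_choiceMixin dual_space.
HB.instance Definition _ := [SubChoice_isSubLmodule of dual_space by <:].

Definition dual_norm (f : dual_space) : R := sup [set `|f x| | x in [set x | `|x| <= 1]].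

Lemma dual_linear (f : dual_space) a x y : f (a *: x + y) = a * f x + f y.
Proof. by case: f => f /= /asboolP[]. Qed.

Lemma dual0 (f : dual_space) : f 0 = 0.
Proof. by have := dual_linear f (-1) 0 0; rewrite scaler0 addr0 mulN1r addNr. Qed.

Lemma dualZ (f : dual_space) a x : f (a *: x) = a * f x.
Proof. by have := dual_linear f a x 0; rewrite dual0 !addr0. Qed.

Lemma dual_has_sup (f : dual_space) : has_sup [set `|f x| | x in [set x | `|x| <= 1]].
Proof.
split; first by exists `|f 0|, 0 => //=; rewrite normr0.
case: f => f /= /asboolP[_ [M fM]]; exists `|M| => _ [x x1 <-].
apply: (le_trans (fM x)); apply: (le_trans (ler_wpM2r _ (ler_norm M))) => //.
by rewrite -[leRHS]mulr1 ler_wpM2l.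
Qed.

Lemma dual_le_norm (f : dual_space) x : `|x| <= 1 -> `|f x| <= dual_norm f.
Proof.
move=> x1; apply: (ub_le_sup (dual_has_sup f).2).
by exists x.
Qed.

Lemma dual_norm_le (f : dual_space) M :
  (forall x, `|x| <= 1 -> `|f x| <= M) -> dual_norm f <= M.
Proof.
by move=> fM; apply: ge_sup; [exact: (dual_has_sup f).1|move=> _ [x x1 <-]; exact: fM].
Qed.

Lemma dual_norm_ge0 (f : dual_space) : 0 <= dual_norm f.
Proof. by apply: le_trans (@dual_le_norm f 0 _); rewrite ?normr0. Qed.

Lemma dual_normD f g : dual_norm (f + g) <= dual_norm f + dual_norm g.
Proof.
apply: dual_norm_le => x x1; change (`|f x + g x| <= dual_norm f + dual_norm g).
by rewrite (le_trans (ler_normD _ _))// lerD// dual_le_norm.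
Qed.

Lemma dual_normZ_le a f : dual_norm (a *: f) <= `|a| * dual_norm f.
Proof.
apply: dual_norm_le => x x1; change (`|a * f x| <= `|a| * dual_norm f).
by rewrite normrM ler_wpM2l// dual_le_norm.
Qed.

Lemma dual_normZ a f : dual_norm (a *: f) = `|a| * dual_norm f.
Proof.
apply/le_anti; rewrite dual_normZ_le/=.
have [->|a0] := eqVneq a 0; first by rewrite normr0 mul0r dual_norm_ge0.
rewrite -ler_pdivlMl ?normr_gt0// -normfV.
by rewrite -{1}[f](scalerK a0) dual_normZ_le.
Qed.

Lemma dual_norm0_eq0 f : dual_norm f = 0 -> f = 0.
Proof.
move=> f0; apply/val_inj/funext => x /=; change (f x = 0).
have [->|x0] := eqVneq x 0; first exact: dual0.
have := @dual_le_norm f (`|x|^-1 *: x) _.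
rewrite normrZ normfV normr_id mulVf ?normr_eq0// lexx f0 dualZ => /(_ isT).
rewrite normr_le0 mulf_eq0 invr_eq0 normr_eq0 (negbTE x0) => /eqP//.
Qed.

HB.instance Definition _ := Lmodule_isNormed.Build R dual_space
  dual_normD dual_normZ dual_norm0_eq0.

End dual_space.

Section bochner.
Context (R : realType) (N : nat).

Definition Gamma : set 'rV[R]_N := [set y | forall i, -1 <= y ord0 i <= 1].

Definition product_density (rho : 'rV[R]_N -> R) :=
  exists rho1 : 'I_N -> R -> R,
    [/\ forall i, measurable_fun setT (rho1 i),
        forall i t, 0 <= rho1 i t,
        forall i, (\int[lebesgue_measure]_(t in `[(-1)%R, 1%R]) (rho1 i t)%:E = 1)%E &
        forall y, rho y = \prod_(i < N) rho1 i (y ord0 i)].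

Definition essentially_bounded (rho : 'rV[R]_N -> R) :=
  exists B, {ae rn_lebesgue R N, forall y, Gamma y -> `|rho y| <= B}.

(* "for almost every y in Gamma" with respect to the measure rho(y) dy *)
Definition ae_rho (rho : 'rV[R]_N -> R) (P : 'rV[R]_N -> Prop) :=
  {ae rn_lebesgue R N, forall y, Gamma y -> 0 < rho y -> P y}.

Context (W : normedModType R) (rho : 'rV[R]_N -> R).

Definition simple_function (s : 'rV[R]_N -> W) :=
  exists n (A : 'I_n -> set (rn R N)) (w : 'I_n -> W),
    (forall i, measurable (A i)) /\ forall y, s y = \sum_(i < n) \1_(A i) y *: w i.

Definition strongly_measurable (v : 'rV[R]_N -> W) :=
  exists s : nat -> 'rV[R]_N -> W,
    (forall n, simple_function (s n)) /\
    ae_rho rho (fun y => s n y @[n --> \oo] --> v y).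

(* +oo when v is not square-integrable *)
Definition bochner_norm (v : 'rV[R]_N -> W) : \bar R :=
  ((\int[rn_lebesgue R N]_(y in Gamma) (`|v y| ^+ 2 * rho y)%:E) `^ 2^-1)%E.

Definition bochner_L2 (v : 'rV[R]_N -> W) :=
  strongly_measurable v /\ (bochner_norm v < +oo)%E.

End bochner.

(* The basis functions are genuine functions, since they are evaluated at the
   points. *)
Record interpolation (R : realType) (N : nat) (rho : 'rV[R]_N -> R) := Interpolation {
  npoints : nat ;
  points : 'I_npoints -> 'rV[R]_N ;
  basis : 'I_npoints -> 'rV[R]_N -> R ;
  points_Gamma : forall j, Gamma (points j) ;
  basis_L2 : forall m, bochner_L2 (W := R) rho (basis m) ;
  unisolvent : forall b : 'I_npoints -> R, exists! c : 'I_npoints -> R,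
    forall j, \sum_(m < npoints) c m * basis m (points j) = b j }.

Arguments points {R N rho} i _.
Arguments basis {R N rho} i _ _.

Section interpolate.
Context (R : realType) (N : nat) (rho : 'rV[R]_N -> R) (W : normedModType R).
Context (I : interpolation rho).

(* the coefficients c_m solving I[v](y_j) = v(y_j) for all j; unisolvence makes
   them unique *)
Definition interp_coef (v : 'rV[R]_N -> W) : 'I_(npoints I) -> W :=
  get [set c | forall j,
        \sum_(m < npoints I) basis I m (points I j) *: c m = v (points I j)].

Definition interpolate (v : 'rV[R]_N -> W) : 'rV[R]_N -> W :=
  fun y => \sum_(m < npoints I) basis I m y *: interp_coef v m.

End interpolate.


Section geometry.
Context (R : realType) (d : nat).
Implicit Types (D : set 'rV[R]_d) (x y z : 'rV[R]_d).

Definition edot x y : R := \sum_(i < d) x ord0 i * y ord0 i.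

(* the norm of the library on 'rV[R]_d is the maximum norm *)
Definition enorm x : R := Num.sqrt (edot x x).

(* Near x, D is the set above the graph of the Lipschitz function g over the
   hyperplane orthogonal to the unit vector e. *)
Definition lipschitz_graph_near D x :=
  exists (e : 'rV[R]_d) (g : 'rV[R]_d -> R) (L r : R),
    [/\ enorm e = 1, 0 < r,
        forall y z, `|g y - g z| <= L * enorm (y - z) &
        forall y, enorm (y - x) < r ->
          (D y <-> g (y - edot y e *: e) < edot y e)].

Definition bounded_lipschitz_domain D :=
  [/\ open D, connected D, D !=set0, bounded_set D &
      forall x, (closure D `\` D) x -> lipschitz_graph_near D x].

(* The vertices of a simplex are the rows of a matrix. *)
Implicit Types S : 'M[R]_(d.+1, d).

Definition face S (J : {set 'I_d.+1}) : set 'rV[R]_d :=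
  [set x | exists l : 'rV[R]_d.+1,
     [/\ forall i, 0 <= l ord0 i, forall i, i \notin J -> l ord0 i = 0,
         \sum_i l ord0 i = 1 & x = l *m S]].

Definition simplex S : set 'rV[R]_d := face S [set: 'I_d.+1]%SET.

Definition affinely_independent S :=
  forall l : 'rV[R]_d.+1, \sum_i l ord0 i = 0 -> l *m S = 0 -> l = 0.

(* When D is not a polytope the simplices cannot fill its closure, hence they
   are only required to be contained in it. *)
Definition triangulation D (T : seq 'M[R]_(d.+1, d)) :=
  [/\ forall S, S \in T -> affinely_independent S,
      forall S, S \in T -> simplex S `<=` closure D &
      forall S S', S \in T -> S' \in T ->
        exists J J', simplex S `&` simplex S' = face S J /\ face S J = face S' J'].

Definition diameter (A : set 'rV[R]_d) : R :=
  sup [set r | exists x y, [/\ A x, A y & r = enorm (x - y)]].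

Definition mesh_width (T : seq 'M[R]_(d.+1, d)) : R :=
  \big[Num.max/0]_(S <- T) diameter (simplex S).

Definition shape_regular (T : nat -> seq 'M[R]_(d.+1, d)) :=
  exists kappa : R, forall k S, S \in T k -> exists x r,
    [/\ 0 < r, forall y, enorm (y - x) <= r -> simplex S y &
        diameter (simplex S) <= kappa * r].

Definition piecewise_polynomial (T : seq 'M[R]_(d.+1, d)) (p : nat)
    (w : 'rV[R]_d -> R) :=
  forall S, S \in T -> exists q : mpoly.mpoly d R,
    (forall m, mpoly.mcoeff m q != 0 -> (mpoly.mdeg m <= p)%N) /\
    forall x, simplex S x -> w x = mpoly.meval (fun i => x ord0 i) q.

(* a linear space of functions that have a continuous representative which is a
   polynomial of bounded degree on each simplex and vanishes off the simplices *)
Definition finite_element_space D (T : seq 'M[R]_(d.+1, d)) (V : set (H10 D)) :=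
  [/\ V 0, forall a v w, V v -> V w -> V (a *: v + w) &
      exists p, forall v, V v -> exists w : 'rV[R]_d -> R,
        [/\ {ae rn_lebesgue R d, forall x, h10_fun v x = w x}, continuous w,
            forall x, (forall S, S \in T -> ~ simplex S x) -> w x = 0 &
            piecewise_polynomial T p w]].

Definition mesh_size (h0 : R) (eta k : nat) : R := h0 / eta%:R ^+ k.

Definition finite_element_hierarchy D (h0 : R) (eta : nat)
    (T : nat -> seq 'M[R]_(d.+1, d)) (V : nat -> set (H10 D)) :=
  [/\ forall k, triangulation D (T k), shape_regular T,
      forall k, mesh_width (T k) = mesh_size h0 eta k,
      forall k, finite_element_space (T k) (V k) &
      forall k, V k `<=` V k.+1].

End geometry.

Section elliptic.
Context (R : realType) (d N : nat) (D : set 'rV[R]_d) (rho : 'rV[R]_N -> R).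
Context (a : 'rV[R]_N -> 'rV[R]_d -> R) (f : 'rV[R]_N -> dual_space (H10 D)).

Definition elliptic_coefficient (amin amax : R) :=
  0 < amin /\
  ae_rho rho (fun y => measurable_fun (D : set (rn R d)) (a y) /\
                       forall x, closure D x -> amin <= a y x <= amax).

(* the bilinear form of - div (a grad u) *)
Definition energy (y : 'rV[R]_N) (v w : H10 D) : R :=
  (\int[rn_lebesgue R d]_(x in D)
     (a y x * \sum_(i < d) h10_grad v i x * h10_grad w i x))%R.

Definition weak_solution (u : 'rV[R]_N -> H10 D) :=
  ae_rho rho (fun y => forall w, energy y (u y) w = f y w).

Definition unique_weak_solution (u : 'rV[R]_N -> H10 D) :=
  [/\ bochner_L2 rho u, weak_solution u &
      forall u', bochner_L2 rho u' -> weak_solution u' ->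
        ae_rho rho (fun y => u' y = u y)].

Definition galerkin (V : set (H10 D)) (uh : 'rV[R]_N -> H10 D) :=
  (forall y, Gamma y -> V (uh y)) /\
  ae_rho rho (fun y => forall w, V w -> energy y (uh y) w = f y w).

End elliptic.

Section multilevel.
Context (R : realType) (N : nat) (rho : 'rV[R]_N -> R) (W : normedModType R).
Context (I : nat -> interpolation rho) (uh : nat -> 'rV[R]_N -> W).

(* u_{h_k} - u_{h_{k-1}}, with u_{h_{-1}} = 0 *)
Definition level_increment (k : nat) : 'rV[R]_N -> W :=
  fun y => if k is k'.+1 then uh k y - uh k' y else uh 0 y.

Definition multilevel (K : nat) : 'rV[R]_N -> W :=
  fun y => \sum_(k < K.+1) interpolate (I (K - k)) (level_increment k) y.

End multilevel.

(* Main.v *)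
Require Import Defs.
From HB Require Import structures.
From mathcomp Require Import all_boot all_order all_algebra.
From mathcomp Require Import all_classical all_reals all_analysis.
From mathcomp Require Import measurable_realfun.
From mathcomp Require Import ring.

Set Implicit Arguments.
Unset Strict Implicit.
Unset Printing Implicit Defensive.

Import Order.TTheory GRing.Theory Num.Theory.
Import numFieldNormedType.Exports.

Local Open Scope classical_set_scope.
Local Open Scope ring_scope.

(** The proof telescopes over the levels.  With [v k] the increment
    [u_{h_k} - u_{h_{k-1}}], the sum of [v 0], ..., [v K] is [u_{h_K}], so on
    [Gamma]
      [u - u_K^ML = (u - u_{h_K}) + sum_(k <= K) (v k - I_{K-k} (v k))].
    The first term is bounded by the spatial error [Cs * h_K ^ alpha].  The
    increments lie in [Lam], so the [k]-th interpolation error is at most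
    [CI * sigma_(K-k) * Czeta * h_k ^ beta], and the choice of [sigma_(K-k)]
    turns this into [Cs * h_K ^ alpha / (K + 1)]; the [K + 1] levels together
    cost another [Cs * h_K ^ alpha].

    What remains is the triangle inequality for [bochner_norm]
    ([bochner_normD]).  The integral of a nonnegative function that is not
    measurable is a lower integral, which is not subadditive, and strong
    measurability only makes [|v| * sqrt rho] an almost everywhere limit of
    measurable functions on a sigma-algebra that is not complete.  Hence this
    weighted norm is replaced by a measurable function that is almost everywhere
    equal to it ([weighted_norm_representative]); the replacement preserves the
    integral ([ae_eq_integral_measurable]), and Minkowski's inequality in [L^2]
    applies to the representatives.  All the terms of the telescoping sum are
    strongly measurable: [u] and the elements of [Lam] by assumption, the
    interpolants because they are finite sums of scalar basis functions times
    fixed vectors. *)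

(** * Almost everywhere equality with measurable functions *)

Lemma measurable_fun_mem d (T : measurableType d) (A : set T) :
  measurable A -> measurable_fun setT (fun x => x \in A).
Proof.
by move=> mA; apply: (@measurable_fun_bool _ _ _ _ true); rewrite setTI preimage_mem_true.
Qed.

Section ae.
Local Open Scope ereal_scope.
Context d (T : measurableType d) (R : realType) (mu : {measure set T -> \bar R}).
Implicit Types f g : T -> \bar R.

(** Both sides are suprema over the simple functions below the integrand, so the
    inequality also holds between lower integrals of nonmeasurable functions. *)
Lemma ge0_le_integralT f g : (forall x, 0 <= f x) -> (forall x, f x <= g x) ->
  \int[mu]_x f x <= \int[mu]_x g x.
Proof.
move=> f0 fg; have g0 x : 0 <= g x by apply: le_trans (fg x).
rewrite !ge0_integralTE//; apply: le_ereal_sup => _ [h hf <-].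
by exists h => // x; apply: le_trans (fg x).
Qed.

(** The lower integral of [f] is sandwiched: changing [g] to [0] or to [+oo] on a null set
    that contains the points where [f] and [g] differ gives measurable functions
    below and above [f] with the integral of [g]. *)
Lemma ae_eq_integral_measurable f g : (forall x, 0 <= f x) -> (forall x, 0 <= g x) ->
  measurable_fun setT g -> {ae mu, forall x, f x = g x} ->
  \int[mu]_x f x = \int[mu]_x g x.
Proof.
move=> f0 g0 mg [N [mN N0 fgN]].
have fgE x : ~ N x -> f x = g x by move=> Nx; apply: contrapT => /fgN.
have patchN (c : \bar R) : 0 <= c ->
    \int[mu]_x (if x \in N then c else g x) = \int[mu]_x g x.
  move=> c0; apply: ge0_ae_eq_integral => //.
  - apply: measurable_fun_ifT => //.
    exact: measurable_fun_mem.
  - by move=> x _; case: ifP.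
  - exists N; split => // x /= H; apply: contrapT => Nx; apply: H => _.
    by rewrite memNset.
apply/le_anti/andP; split.
- rewrite -[leRHS](patchN +oo)//; apply: ge0_le_integralT => // x.
  by case: ifPn => [_|]; [rewrite leey|rewrite notin_setE => /fgE ->].
- rewrite -[leLHS](patchN 0)//; apply: ge0_le_integralT => x; first by case: ifP.
  by case: ifPn => [_|]; [exact: f0|rewrite notin_setE => /fgE ->].
Qed.

(** The upper limit of [h] is measurable and defined everywhere, also where the
    sequence does not converge. *)
Lemma ae_lim_measurable (h : nat -> T -> R) (f : T -> R) :
  (forall n, measurable_fun setT (h n)) ->
  {ae mu, forall x, h n x @[n --> \oo] --> f x} ->
  exists2 g : T -> R, measurable_fun setT g & {ae mu, forall x, f x = g x}.
Proof.
move=> mh hf; exists (fun x => fine (limn_esup (fun n => (h n x)%:E))).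
  apply: (measurableT_comp (f := fine)) => //.
  apply: (@measurable_fun_limn_esup _ _ _ setT (fun n x => (h n x)%:E)) => n.
  exact/measurable_EFinP.
apply: filterS hf => x hx.
have hE : (h n x)%:E @[n --> \oo] --> (f x)%:E by apply: cvg_EFin => //; exact: nearW.
rewrite is_cvg_limn_esupE; last by apply/cvg_ex; exists (f x)%:E.
by rewrite (cvg_lim _ hE).
Qed.

End ae.

(** * Strongly measurable functions *)
Section bochner_norm.
Context (R : realType) (N : nat) (rho : 'rV[R]_N -> R).
Local Notation mu := (rn_lebesgue R N).

#[local] Instance ae_rho_filter : Filter (ae_rho rho).
Proof.
rewrite /ae_rho; split => [|P Q P1 Q1|P Q PQ P1].
- by apply: aeW.
- apply: (@filterS2 (rn R N) _ _ _ _ _ _ P1 Q1) => y Py Qy Gy r0.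
  by split; [exact: Py|exact: Qy].
- by apply: (@filterS (rn R N) _ _ _ _ _ P1) => y Py Gy r0; exact/PQ/Py.
Qed.

Lemma ae_rho_Gamma : ae_rho rho (@Gamma R N).
Proof. by apply: aeW. Qed.

Section strong_measurability.
Context (W : normedModType R).
Implicit Types v w : 'rV[R]_N -> W.

Lemma simple_functionD v w :
  simple_function v -> simple_function w -> simple_function (v + w).
Proof.
move=> [n [A [x [mA vE]]]] [m [B [z [mB wE]]]].
exists (n + m)%N, (fun i => match fintype.split i with inl j => A j | inr k => B k end),
  (fun i => match fintype.split i with inl j => x j | inr k => z k end); split.
  by move=> i; case: fintype.split.
move=> y; rewrite big_split_ord/= [LHS]/GRing.add/= vE wE.
congr (_ + _); apply: eq_bigr => i _.
- by rewrite (unsplitK (inl i)).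
- by rewrite (unsplitK (inr i)).
Qed.

Lemma strongly_measurable_Gamma v w : (forall y, Gamma y -> v y = w y) ->
  strongly_measurable rho v -> strongly_measurable rho w.
Proof.
move=> vw [s [ss sv]]; exists s; split => //.
by apply: filterS2 sv ae_rho_Gamma => y sy Gy; rewrite -vw.
Qed.

Lemma strongly_measurableD v w : strongly_measurable rho v ->
  strongly_measurable rho w -> strongly_measurable rho (v + w).
Proof.
move=> [s [ss sv]] [t [st tw]]; exists (fun n => s n + t n); split.
  by move=> n; exact: simple_functionD.
by apply: filterS2 sv tw => y sy ty; exact: cvgD.
Qed.

Lemma strongly_measurable0 : strongly_measurable rho (0 : 'rV[R]_N -> W).
Proof.
exists (fun=> 0); split; last by apply: aeW => y _ _; exact: cvg_cst.
move=> _; exists 0%N, (fun=> set0), (fun=> 0); split => [[]//|y].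
by rewrite big_ord0.
Qed.

Lemma strongly_measurable_sum (I : Type) (r : seq I) (F : I -> 'rV[R]_N -> W) :
  (forall i, strongly_measurable rho (F i)) ->
  strongly_measurable rho (\sum_(i <- r) F i).
Proof.
move=> mF; elim/big_rec: _ => [|i v _ mv]; first exact: strongly_measurable0.
exact: strongly_measurableD.
Qed.

Lemma strongly_measurableZl (b : 'rV[R]_N -> R) (x : W) :
  strongly_measurable (W := R) rho b ->
  strongly_measurable rho (fun y => b y *: x).
Proof.
move=> [s [ss sb]]; exists (fun n y => s n y *: x); split.
  move=> n; have [m [A [c [mA sE]]]] := ss n.
  exists m, A, (fun i => c i *: x); split => // y.
  by rewrite sE scaler_suml; apply: eq_bigr => i _; rewrite scalerA.
by apply: filterS sb => y sy; exact: cvgZr_tmp.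
Qed.

Lemma strongly_measurableN v :
  strongly_measurable rho v -> strongly_measurable rho (- v).
Proof.
move=> [s [ss sv]]; exists (fun n => - s n); split.
  move=> n; have [m [A [c [mA sE]]]] := ss n.
  exists m, A, (fun i => - c i); split => // y.
  rewrite [LHS]/GRing.opp/= sE -sumrN.
  by apply: eq_bigr => i _; rewrite scalerN.
by apply: filterS sv => y sy; exact: cvgN.
Qed.

(** By induction on the number of sets, splitting on membership in the first one;
    the induction needs the offset [w0], which absorbs its vector. *)
Lemma measurable_norm_simple v : simple_function v ->
  measurable_fun setT (fun y : rn R N => `|v y|).
Proof.
move=> [n [A [x [mA vE]]]].
suff H (w0 : W) : measurable_fun setT
    (fun y : rn R N => `|w0 + \sum_(i < n) \1_(A i) y *: x i|).
  by have := H 0; under eq_fun do rewrite add0r -vE.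
elim: n A x mA {v vE} w0 => [|n IH] A x mA w0.
  by under eq_fun do rewrite big_ord0; exact: measurable_cst.
rewrite (_ : (fun y => _) = fun y : rn R N => if y \in A ord0
    then `|w0 + x ord0 + \sum_(i < n) \1_(A (lift ord0 i)) y *: x (lift ord0 i)|
    else `|w0 + \sum_(i < n) \1_(A (lift ord0 i)) y *: x (lift ord0 i)|).
  apply: measurable_fun_ifT.
  - exact: measurable_fun_mem.
  - exact: (IH (fun i => A (lift ord0 i)) (fun i => x (lift ord0 i))).
  - exact: (IH (fun i => A (lift ord0 i)) (fun i => x (lift ord0 i))).
apply/funext => y; rewrite big_ord_recl indicE.
by case: (y \in A ord0); rewrite ?scale1r ?scale0r ?add0r ?addrA.
Qed.

End strong_measurability.

Lemma measurable_Gamma : measurable (@Gamma R N : set (rn R N)).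
Proof.
rewrite (_ : @Gamma R N = \bigcap_(i in [set: 'I_N]) ((fun x : rn R N =>
   (x : 'rV[R]_N) ord0 i : measurableTypeR R) @^-1` `[-1, 1])); last first.
  apply/seteqP; split => y /= Hy i; first by move=> _ /=; rewrite in_itv/=; exact: Hy.
  by have := Hy i I; rewrite /= in_itv.
apply: fin_bigcap_measurable => // i _.
rewrite -[X in measurable X]setTI; exact: measurable_rn_coord.
Qed.

Context (hrho : product_density rho).

Lemma density_ge0 y : 0 <= rho y.
Proof. by have [r [_ r0 _ ->]] := hrho; apply: prodr_ge0. Qed.

Lemma measurable_density : measurable_fun setT (rho : rn R N -> R).
Proof.
have [r [mr _ _ rE]] := hrho.
rewrite (_ : rho = fun y => \prod_(i < N) r i (y ord0 i)); last exact/funext.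
apply: measurable_prod => i _; apply: (measurableT_comp (mr i)).
exact: measurable_rn_coord.
Qed.

(** * The triangle inequality for the Bochner norm *)
Section triangle.
Context (W : normedModType R).
Implicit Types v w : 'rV[R]_N -> W.

(** The Bochner norm of [v] is the [L^2] norm of this real function on the whole
    space. *)
Definition weighted_norm v (y : rn R N) : R :=
  \1_(@Gamma R N) y * (`|v y| * Num.sqrt (rho y)).

Lemma bochner_norm_Gamma v w : (forall y, Gamma y -> v y = w y) ->
  bochner_norm rho v = bochner_norm rho w.
Proof.
move=> vw; rewrite /bochner_norm; congr (_ `^ _)%E.
by apply: eq_integral => y /set_mem Gy; rewrite vw.
Qed.

Lemma bochner_normE v :
  bochner_norm rho v = ((\int[mu]_y (weighted_norm v y ^+ 2)%:E) `^ 2^-1)%E.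
Proof.
rewrite /bochner_norm integral_mkcond; congr (_ `^ _)%E.
apply: eq_integral => y _; rewrite patchE /weighted_norm indicE.
case: ifP => _; last by rewrite mul0r expr0n.
by rewrite mul1r exprMn sqr_sqrtr// density_ge0.
Qed.

(** Where [rho] vanishes the convergence of the simple functions is not
    controlled, but there all the weighted norms are [0]. *)
Lemma weighted_norm_representative v : strongly_measurable rho v ->
  exists2 g : rn R N -> R, measurable_fun setT g &
    {ae mu, forall y, weighted_norm v y = g y}.
Proof.
move=> [s [ss sv]]; apply: (@ae_lim_measurable _ _ _ mu (fun n => weighted_norm (s n))).
  move=> n; apply: measurable_funM; first exact: (measurable_indic measurable_Gamma).
  apply: measurable_funM; first exact: measurable_norm_simple.
  have msqrt : measurable_fun [set: R] (@Num.sqrt R).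
    by apply: continuous_measurable_fun; exact: sqrt_continuous.
  exact: (measurableT_comp msqrt measurable_density).
rewrite /ae_rho in sv; refine (@filterS (rn R N) _ _ _ _ _ sv) => y sy.
rewrite /weighted_norm indicE.
have [/set_mem Gy|_] := boolP (y \in _); last first.
  by under eq_fun do rewrite mul0r; rewrite mul0r; exact: cvg_cst.
have [r0|] := ltP 0 (rho y).
  by apply: cvgMl_tmp; apply: cvgMr_tmp; apply: cvg_norm; exact: sy.
by move=> /ler0_sqrtr ->; under eq_fun do rewrite !mulr0; rewrite !mulr0; exact: cvg_cst.
Qed.

Lemma bochner_norm_LnormE v (g : rn R N -> R) : measurable_fun setT g ->
  {ae mu, forall y, weighted_norm v y = g y} ->
  bochner_norm rho v = 'N[mu]_2[EFin \o g]%E.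
Proof.
move=> mg vg; rewrite bochner_normE unlock; congr (_ `^ _)%E.
rewrite [LHS](ae_eq_integral_measurable (g := fun y => (g y ^+ 2)%:E)).
- apply: eq_integral => y _.
  by rewrite /= powR_mulrn// real_normK// num_real.
- by move=> y; rewrite lee_fin sqr_ge0.
- by move=> y; rewrite lee_fin sqr_ge0.
- by apply/measurable_EFinP; exact: measurable_funX.
- by apply: filterS vg => y ->.
Qed.

Lemma bochner_normD v w : strongly_measurable rho v -> strongly_measurable rho w ->
  (bochner_norm rho (v + w)%R <= bochner_norm rho v + bochner_norm rho w)%E.
Proof.
move=> mv mw.
have [g mg vg] := weighted_norm_representative mv.
have [h mh wh] := weighted_norm_representative mw.
have [k mk vwk] := weighted_norm_representative (strongly_measurableD mv mw).
rewrite (bochner_norm_LnormE mg vg) (bochner_norm_LnormE mh wh).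
apply: (@le_trans _ _ ('N[mu]_2[EFin \o (g \+ h)%R])%E); last first.
  by apply: eminkowski => //; exact: lee1n.
rewrite (bochner_norm_LnormE mk vwk) unlock.
apply: gt0_ler_poweR; rewrite ?in_itv/= ?leey ?integral_ge0//.
apply: ae_ge0_le_integral => //.
- apply/measurable_EFinP/(measurableT_comp (measurable_powR 2)).
  exact: measurableT_comp.
- apply/measurable_EFinP/(measurableT_comp (measurable_powR 2)).
  by apply: measurableT_comp => //; exact: measurable_funD.
apply: filterS3 vg wh vwk => y vgy why vwky _.
rewrite lee_fin; apply: ge0_ler_powR; rewrite ?nnegrE//.
(* [g + h] is nonnegative only almost everywhere, hence the absolute value *)
rewrite -vgy -why -vwky /weighted_norm -mulrDr -mulrDl ger0_norm; last first.
  by rewrite !mulr_ge0// ?indicE// sqrtr_ge0.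
apply: le_trans (ler_norm _); rewrite ler_wpM2l ?indicE//.
by rewrite ler_wpM2r ?sqrtr_ge0// ler_normD.
Qed.

Lemma bochner_norm0 : bochner_norm rho (0 : 'rV[R]_N -> W) = 0%E.
Proof.
rewrite /bochner_norm (eq_integral (fun=> 0%E)); last first.
  by move=> y _; rewrite [(0 : _ -> _) y]/GRing.zero/= normr0 expr0n mul0r.
by rewrite integral0 poweR0r.
Qed.

Lemma bochner_norm_sum (I : Type) (r : seq I) (F : I -> 'rV[R]_N -> W) :
  (forall i, strongly_measurable rho (F i)) ->
  (bochner_norm rho (\sum_(i <- r) F i)%R <= \sum_(i <- r) bochner_norm rho (F i))%E.
Proof.
move=> mF; elim: r => [|i r IH]; first by rewrite !big_nil bochner_norm0.
rewrite !big_cons; apply: le_trans (leeD2l _ IH).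
by apply: bochner_normD; [exact: mF|exact: strongly_measurable_sum].
Qed.

End triangle.
End bochner_norm.

(** * Interpolation operators *)
Section interpolate.
Context (R : realType) (N : nat) (rho : 'rV[R]_N -> R) (W : normedModType R).
Implicit Types (I : interpolation rho) (v w : 'rV[R]_N -> W).

(** The coefficients depend on the values at the points only, and these lie in
    [Gamma]. *)
Lemma interpolate_Gamma I v w :
  (forall y, Gamma y -> v y = w y) -> interpolate I v = interpolate I w.
Proof.
move=> vw; rewrite /interpolate.
suff -> : @interp_coef _ _ _ _ I v = @interp_coef _ _ _ _ I w by [].
rewrite /interp_coef; congr get; apply/seteqP; split => c cE j; rewrite [LHS]cE.
- by apply: vw; exact: points_Gamma.
- by apply/esym/vw; exact: points_Gamma.
Qed.

Lemma strongly_measurable_interpolate I v : strongly_measurable rho (interpolate I v).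
Proof.
rewrite (_ : interpolate I v =
    \sum_(m < npoints I) (fun y : 'rV[R]_N =>
      Defs.basis I m y *: @interp_coef _ _ _ _ I v m)); last first.
  by apply/funext => y; rewrite fct_sumE.
by apply: strongly_measurable_sum => m; apply: strongly_measurableZl; case: (basis_L2 m).
Qed.

End interpolate.

(** * The multilevel error *)
Lemma sum_level_increment (R : realType) (N : nat) (W : normedModType R)
    (uh : nat -> 'rV[R]_N -> W) (K : nat) y :
  \sum_(k < K.+1) level_increment uh k y = uh K y.
Proof.
elim: K => [|K IH]; first by rewrite big_ord1.
by rewrite big_ord_recr/= IH addrC subrK.
Qed.

Lemma mesh_size_gt0 (R : realType) (h0 : R) (eta k : nat) :
  0 < h0 -> (1 < eta)%N -> 0 < mesh_size h0 eta k.
Proof. by move=> h0_gt0 eta1; rewrite divr_gt0// exprn_gt0// ltr0n ltnW. Qed.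

Theorem mainTheorem2 (R : realType) (d N : nat) (hd : (1 <= d <= 3)%N)
  (D : set 'rV[R]_d) (hD : bounded_lipschitz_domain D)
  (rho : 'rV[R]_N -> R)
  (hrho : product_density rho) (hrho_bounded : essentially_bounded rho)
  (a : 'rV[R]_N -> 'rV[R]_d -> R) (amin amax : R)
  (ha : elliptic_coefficient D rho a amin amax)
  (f : 'rV[R]_N -> dual_space (H10 D)) (hf : bochner_L2 rho f)
  (u : 'rV[R]_N -> H10 D)
  (hu : unique_weak_solution rho a f u)
  (hu_cont : {within @Gamma R N, continuous u})
  (h0 : R) (eta : nat) (hh0 : 0 < h0) (heta : (1 < eta)%N)
  (T : nat -> seq 'M[R]_(d.+1, d)) (V : nat -> set (H10 D))
  (hV : finite_element_hierarchy h0 eta T V)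
  (uh : nat -> 'rV[R]_N -> H10 D)
  (huh : forall k, galerkin rho a f (V k) (uh k))
  (I : nat -> interpolation rho)
  (alpha beta Cs CI Czeta : R)
  (halpha : 0 < alpha) (hbeta : 0 < beta)
  (hCs : 0 < Cs) (hCI : 0 < CI) (hCzeta : 0 < Czeta)
  (spatial_error : forall k,
     (bochner_norm rho (u - uh k)%R <= (Cs * mesh_size h0 eta k `^ alpha)%:E)%E)
  (* the Banach space of functions Lam is included in L^2_rho(Gamma; H^1_0(D)) by iota *)
  (Lam : completeNormedModType R)
  (iota : {linear Lam -> ('rV[R]_N -> H10 D)})
  (iota_inj : forall v w, (forall y, Gamma y -> iota v y = iota w y) -> v = w)
  (iota_L2 : forall v, bochner_L2 rho (iota v))
  (uhL : nat -> Lam)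
  (huhL : forall k y, Gamma y -> iota (uhL k) y = uh k y)
  (zeta : Lam -> R) (sigma : nat -> R)
  (sigma_decreasing : forall k l, (k <= l)%N -> sigma l <= sigma k)
  (* without this sign condition the bounds on zeta do not bound sigma k * zeta v,
     and the statement is false *)
  (sigma_ge0 : forall k, 0 <= sigma k)
  (interpolation_error : forall v k,
     (bochner_norm rho (iota v - interpolate (I k) (iota v))%R
        <= (CI * sigma k * zeta v)%:E)%E)
  (zeta_uh : forall k, zeta (uhL k) <= Czeta * h0 `^ beta)
  (zeta_increment : forall k,
     zeta (uhL k.+1 - uhL k) <= Czeta * mesh_size h0 eta k.+1 `^ beta)
  (K : nat) (hK : (0 < K)%N)
  (sigma_choice : forall k, (k <= K)%N ->
     sigma (K - k)%N <= Cs * (K.+1%:R * CI * Czeta)^-1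
                        * mesh_size h0 eta K `^ alpha
                        * mesh_size h0 eta k `^ (- beta)) :
  (bochner_norm rho (u - multilevel I uh K)%R
     <= (2 * Cs * mesh_size h0 eta K `^ alpha)%:E)%E.
Proof.
pose v k : Lam := if k is k'.+1 then uhL k - uhL k' else uhL 0.
pose err k := (iota (v k) - interpolate (I (K - k)%N) (iota (v k)))%R.
have vE k y : Gamma y -> level_increment uh k y = iota (v k) y.
  move=> Gy; case: k => [|k] /=; first by rewrite huhL.
  by rewrite linearB [RHS]/GRing.add/= [in RHS]/GRing.opp/= !huhL.
have splitE y : Gamma y ->
    (u - multilevel I uh K) y = ((u - uh K) + \sum_(k < K.+1) err k) y.
  move=> Gy; change (u y - multilevel I uh K y =
    (u y - uh K y) + (\sum_(k < K.+1) err k) y).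
  suff -> : (\sum_(k < K.+1) err k) y = uh K y - multilevel I uh K y.
    by rewrite addrA subrK.
  rewrite fct_sumE -(sum_level_increment uh K y) -sumrB; apply: eq_bigr => k _.
  rewrite vE// (@interpolate_Gamma _ _ _ _ _ _ (iota (v k)))// => z; exact: vE.
have mu_u : strongly_measurable rho u by case: hu => -[].
have muhK : strongly_measurable rho (uh K).
  by apply: (strongly_measurable_Gamma (huhL K)); case: (iota_L2 (uhL K)).
have merr k : strongly_measurable rho (err k).
  apply: strongly_measurableD; first by case: (iota_L2 (v k)).
  exact/strongly_measurableN/strongly_measurable_interpolate.
have err_le (k : 'I_K.+1) :
    (bochner_norm rho (err k) <= (Cs * mesh_size h0 eta K `^ alpha / K.+1%:R)%:E)%E.
  apply: le_trans (interpolation_error _ _) _; rewrite lee_fin.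
  set h := mesh_size h0 eta in sigma_choice zeta_increment *.
  have hk0 : 0 < h k `^ beta by rewrite powR_gt0 // mesh_size_gt0.
  (* at level 0 the increment is [u_{h_0}] itself and [mesh_size h0 eta 0 = h0] *)
  have zeta_v : zeta (v k) <= Czeta * h k `^ beta.
    case: (k : nat) => [|k']; last exact: zeta_increment.
    by rewrite /h /mesh_size expr0 divr1; exact: zeta_uh.
  apply: (@le_trans _ _ (CI * sigma (K - k)%N * (Czeta * h k `^ beta))).
    by rewrite ler_wpM2l// mulr_ge0// ltW.
  have := sigma_choice k (ltn_ord k : (k <= K)%N); rewrite powRN => sigma_k.
  have := ler_wpM2l (ltW hCI) sigma_k.
  move=> /(ler_wpM2r (ltW (mulr_gt0 hCzeta hk0))) /le_trans; apply.
  rewrite le_eqVlt; apply/orP; left; apply/eqP; field.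
  by rewrite !gt_eqF.
rewrite (bochner_norm_Gamma rho splitE).
apply: le_trans (bochner_normD _ _ _) _ => //.
- exact/strongly_measurableD/strongly_measurableN.
- exact: strongly_measurable_sum.
rewrite -mulrA mulr2n mulrDl !mul1r EFinD; apply: leeD; first exact: spatial_error.
apply: le_trans (bochner_norm_sum _ _ _) _ => //.
apply: (@le_trans _ _ (\sum_(k < K.+1) (Cs * mesh_size h0 eta K `^ alpha / K.+1%:R)%:E)%E).
  by apply: lee_sum => k _; exact: err_le.
by rewrite sumEFin sumr_const card_ord -[X in X%:E]mulr_natr divfK// pnatr_eq0.
Qed.
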